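(* Let $a = (a_1,\ldots,a_n)^\top \in \mathbb{Z}_{>0}^n$ and $b \in \mathbb{Z}_{\ge 0}$. If the knapsack feasibility problem $a^\top x = b$, $x \in \mathbb{Z}_{\ge 0}^n$, has a solution, then there is a solution $x$ satisfying $$\|x\|_0 \le 1 + \left\lfloor \log_2\left( \frac{\min\{a_1,\ldots,a_n\}}{\gcd(a)} \right) \right\rfloor.$$
   Context: For $x\in\mathbb{R}^n$, $\|x\|_0 := |\{i : x_i \neq 0\}|$. $\gcd(a)$ is the greatest common divisor of $a_1,\ldots,a_n$. *)

(* Defs.v *)
From HB Require Import structures.
From mathcomp Require Import all_boot all_order all_algebra.
From mathcomp Require Import reals exp.

Set Implicit Arguments.
Unset Strict Implicit.
Unset Printing Implicit Defensive.

Import Order.TTheory GRing.Theory Num.Theory.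
Local Open Scope ring_scope.

Definition l0norm (V : nmodType) (n : nat) (x : 'cV[V]_n) : nat :=
  #|[set i : 'I_n | x i ord0 != 0]|.

Definition vgcd (n : nat) (a : 'cV[nat]_n) : nat :=
  \big[gcdn/0%N]_(i < n) a i ord0.

(* The minimum has no neutral element in nat, so the iteration starts from an
   entry of the vector; this is why the dimension is a successor. *)
Definition vmin (n : nat) (a : 'cV[nat]_n.+1) : nat :=
  \big[minn/a ord0 ord0]_(i < n.+1) a i ord0.

Definition log2 (R : realType) (t : R) : R := ln t / ln 2.

(* Main.v *)
Require Import Defs.
From HB Require Import structures.
From mathcomp Require Import all_boot all_order all_algebra.
From mathcomp Require Import reals exp.
From mathcomp Require Import zify.

Import Order.TTheory GRing.Theory Num.Theory.
Local Open Scope ring_scope.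

(** Let [m] be an index attaining the minimum. Among all solutions take one that
    maximises first [x m] and then the sum of the squares of the entries, and let
    [T] be its support without [m]. If [2 ^ #|T|] exceeded [a m / gcd a], two
    subset sums over [T] would agree modulo [a m], so there would be disjoint
    [A, B] in [T], not both empty, with [a(A) = a(B) + k * a m]. For [k > 0],
    trading one unit of each item of [A] for one of each item of [B] and [k] units
    of [m] increases [x m]. For [k = 0] the trade works in both directions, and by
    strict convexity one of them increases the sum of squares. *)

Section Exchange.
Local Open Scope nat_scope.
Variable I : finType.
Implicit Types (a c x y z : I -> nat) (A B T : {set I}).

(** Pigeonhole: the [2 ^ #|T|] subsets of [T] have fewer than that many residues to share. Removing
    the common part of two colliding subsets makes them disjoint and keeps the congruence. *)
Lemma subset_sum_collision T c q : 0 < q < 2 ^ #|T| ->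
  exists A B, [/\ A \subset T, B \subset T, [disjoint A & B], A != B &
    \sum_(i in A) c i = \sum_(i in B) c i %[mod q]].
Proof.
case/andP=> q_gt0 ltqT.
pose h A : 'I_q := Ordinal (ltn_pmod (\sum_(i in A) c i) q_gt0).
have : ~~ dinjectiveb h (mem (powerset T)).
  apply/negP => /dinjectiveP h_inj; move: ltqT.
  rewrite -card_powerset -(card_in_imset h_inj) ltnNge.
  by rewrite -[X in _ <= X](card_ord q) max_card.
case/dinjectivePn => U; rewrite powersetE => UT [V].
rewrite !inE => /andP[VU VT] /(congr1 val) /= eqUV.
exists (U :\: V), (V :\: U); split.
- by apply: subset_trans UT; apply: subsetDl.
- by apply: subset_trans VT; apply: subsetDl.
- rewrite -setI_eq0; apply/eqP/setP => i; rewrite !inE.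
  by case: (i \in U); case: (i \in V).
- apply: contraNneq VU => /setP eqD; apply/eqP/setP => i.
  by have := eqD i; rewrite !inE; case: (i \in U); case: (i \in V).
- apply/eqP; rewrite -(eqn_modDl (\sum_(i in U :&: V) c i)).
  by rewrite -big_setID setIC -big_setID eqUV.
Qed.

Lemma square_spread n : 0 < n -> n ^ 2 + n ^ 2 + 1 <= n.-1 ^ 2 + n.+1 ^ 2.
Proof. by case: n => // n _; rewrite -!mulnn; lia. Qed.

(** The truncated subtraction comes last; it is exact once [x] is positive on [A]. *)
Definition trade x A B m k : I -> nat :=
  fun i => x i + (i \in B) + k * (i == m) - (i \in A).

Lemma sum_indic c A : \sum_i c i * (i \in A) = \sum_(i in A) c i.
Proof.
by rewrite [RHS]big_mkcond; apply: eq_bigr => i _; case: ifP; rewrite ?muln1 ?muln0.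
Qed.

Lemma sum_trade a x A B m k : (forall i, i \in A -> 0 < x i) ->
  \sum_(i in A) a i = \sum_(i in B) a i + k * a m ->
  \sum_i a i * trade x A B m k i = \sum_i a i * x i.
Proof.
(* Adding the sum over [A] to both sides cancels the subtraction in [trade]. *)
move=> x_gt0 eqAB; apply/eqP; rewrite -(eqn_add2r (\sum_(i in A) a i)).
rewrite {2}eqAB -!sum_indic addnA mulnC.
have -> : a m * k = \sum_i a i * (k * (i == m)).
  rewrite (bigD1 m) //= eqxx muln1 big1 ?addn0 // => i /negPf ->.
  by rewrite !muln0.
rewrite -!big_split /=; apply/eqP; apply: eq_bigr => i _.
rewrite -!mulnDr /trade subnK //; case iA: (i \in A) => //.
by rewrite -addnA ltn_addr // x_gt0.
Qed.

(** Positive coefficients bound every entry of a solution by [b], so the maximum is taken over a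
    finite type. *)
Lemma lexi_max_solution a x0 m : (forall i, 0 < a i) ->
  exists x, \sum_i a i * x i = \sum_i a i * x0 i /\
    forall y, \sum_i a i * y i = \sum_i a i * x0 i ->
      y m <= x m /\ (y m = x m -> \sum_i y i ^ 2 <= \sum_i x i ^ 2).
Proof.
move=> a_gt0; set b := \sum_i a i * x0 i.
pose sol (f : {ffun I -> 'I_b.+1}) := \sum_i a i * f i == b.
(* [W] exceeds every possible sum of squares, so maximising [obj] is maximising
   lexicographically. *)
pose W := (\sum_(i : I) b ^ 2).+1.
pose obj (f : {ffun I -> 'I_b.+1}) := W * f m + \sum_i f i ^ 2.
have le_b y i : \sum_i a i * y i = b -> y i <= b.
  move<-; rewrite (bigD1 i) //=; apply: leq_trans (leq_addr _ _).
  by rewrite leq_pmull.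
have finE y : \sum_i a i * y i = b ->
    exists2 f : {ffun I -> 'I_b.+1}, sol f & forall i, f i = y i :> nat.
  move=> yb; exists [ffun i => inord (y i)].
    rewrite /sol -[X in _ == X]yb; apply/eqP/eq_bigr => i _.
    by rewrite ffunE inordK // ltnS le_b.
  by move=> i; rewrite ffunE inordK // ltnS le_b.
have [f0 f0sol _] := finE x0 erefl.
have [f /eqP fsol fmax] := arg_maxnP obj f0sol.
exists (fun i => f i : nat); split=> // y /finE[g gsol gE].
have := fmax g gsol; rewrite /obj /= gE (eq_bigr (fun i => y i ^ 2)); last first.
  by move=> i _; rewrite gE.
have : \sum_i f i ^ 2 < W.
  by rewrite ltnS; apply: leq_sum => i _; rewrite leq_exp2r // -ltnS ltn_ord.
move=> ltFW le_obj; split=> [|eq_m]; last by move: le_obj; rewrite eq_m leq_add2l.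
rewrite -ltnS -(ltn_pmul2l (ltn0Sn _ : 0 < W)) mulnSr.
apply: leq_ltn_trans (leq_addr _ _) (leq_ltn_trans le_obj _).
by rewrite ltn_add2l.
Qed.

(** Any index [m] and common divisor [g] are allowed; the theorem takes an index of the minimum and
    the gcd. *)
Lemma sparse_solution a x0 m g : (forall i, 0 < a i) -> (forall i, g %| a i) ->
  exists x, \sum_i a i * x i = \sum_i a i * x0 i /\
    2 ^ #|[set i | x i != 0] :\ m| * g <= a m.
Proof.
move=> a_gt0 dvd_g.
have g_gt0 : 0 < g by apply: dvdn_gt0 (dvd_g m).
have [x [xsol xmax]] := lexi_max_solution a x0 m a_gt0.
exists x; split=> //; set T := _ :\ m.
rewrite -leq_divRL // leqNgt; apply/negP => small.
(* Dividing all coefficients by [g] first shrinks the modulus from [a m] to [a m %/ g]. *)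
have [|A [B []]] := subset_sum_collision T (fun i => a i %/ g) (a m %/ g).
  by rewrite small divn_gt0 // dvdn_leq.
have sumE (C : {set I}) : \sum_(i in C) a i = (\sum_(i in C) a i %/ g) * g.
  by rewrite big_distrl /=; apply: eq_bigr => i _; rewrite divnK.
(* The collision is symmetric in [A] and [B]; this order makes [k] a natural number. *)
wlog leBA : A B / \sum_(i in B) a i <= \sum_(i in A) a i.
  move=> IH AT BT dAB nAB eqAB.
  case/orP: (leq_total (\sum_(i in B) a i) (\sum_(i in A) a i)) => le.
    exact: IH le AT BT dAB nAB eqAB.
  by apply: (IH B A) => //; rewrite 1?disjoint_sym 1?eq_sym.
move=> AT BT dAB nAB eqAB.
have [k eqk] : exists k, \sum_(i in A) a i = \sum_(i in B) a i + k * a m.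
  have : a m %| \sum_(i in A) a i - \sum_(i in B) a i.
    rewrite !sumE -mulnBl -(divnK (dvd_g m)) dvdn_pmul2r // -eqn_mod_dvd.
      exact/eqP.
    by move: leBA; rewrite !sumE leq_pmul2r.
  by case/dvdnP => k eqk; exists k; rewrite -eqk subnKC.
have posT (C : {set I}) : C \subset T -> forall i, i \in C -> 0 < x i.
  by move=> CT i /(subsetP CT); rewrite !inE lt0n => /andP[].
have mT (C : {set I}) : C \subset T -> (m \in C) = false.
  by move=> CT; apply/negP => /(subsetP CT); rewrite !inE eqxx.
have ysol := sum_trade a x A B m k (posT A AT) eqk.
have [le_y sq_y] := xmax _ (etrans ysol xsol).
(* Neither set contains [m], so the trade raises the entry at [m] by exactly [k]. *)
have k0 : k = 0 by move: le_y; rewrite /trade mT // mT // eqxx; lia.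
have eqk' : \sum_(i in B) a i = \sum_(i in A) a i + 0 * a m.
  by rewrite eqk k0 !addn0.
have zsol := sum_trade a x B A m 0 (posT B BT) eqk'.
have [_ sq_z] := xmax _ (etrans zsol xsol).
have {}sq_y : \sum_i trade x A B m k i ^ 2 <= \sum_i x i ^ 2.
  by apply: sq_y; rewrite /trade k0 mT // mT //; lia.
have {}sq_z : \sum_i trade x B A m 0 i ^ 2 <= \sum_i x i ^ 2.
  by apply: sq_z; rewrite /trade mT // mT //; lia.
(* Together the two opposite trades gain at least [#|A| + #|B|] in squares while neither may gain
   anything, so both sets are empty, against [A != B]. *)
have convex : \sum_i (x i ^ 2 + x i ^ 2 + (i \in A) + (i \in B)) <=
    \sum_i (trade x A B m k i ^ 2 + trade x B A m 0 i ^ 2).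
  apply: leq_sum => i _; rewrite /trade k0.
  have := disjointFr dAB (x := i); rewrite mul0n addn0.
  have [iA /(_ isT) -> | _ _] := boolP (i \in A).
    have := square_spread _ (posT A AT i iA).
    by rewrite /= !(addn0, addn1, subn1, subn0).
  have [iB | _] := boolP (i \in B); last by rewrite /= !(addn0, subn0).
  have := square_spread _ (posT B BT i iB).
  by rewrite /= !(addn0, addn1, subn1, subn0) [X in _ <= X]addnC.
move: convex; rewrite !big_split /= => convex.
have AB0 : \sum_i (i \in A : nat) = 0 /\ \sum_i (i \in B : nat) = 0 by lia.
have set0E (C : {set I}) : \sum_i (i \in C : nat) = 0 -> C = set0.
  move/eqP; rewrite sum_nat_eq0 => /forallP C0.
  by apply/setP => i; have := C0 i; rewrite inE; case: (i \in C).
by case: AB0 => /set0E A0 /set0E B0; rewrite A0 B0 eqxx in nAB.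
Qed.

End Exchange.

Lemma le_floor_log2 (R : realType) (s p q : nat) : (0 < q)%N ->
  (2 ^ s * q <= p)%N -> s%:Z <= Num.floor (log2 (p%:R / q%:R : R)).
Proof.
move=> q_gt0 le_p.
have q0 : 0 < q%:R :> R by rewrite ltr0n.
have le_pq : 2 ^+ s <= p%:R / q%:R :> R.
  by rewrite ler_pdivlMr // -natrX -natrM ler_nat.
have ln2 : 0 < ln 2 :> R by rewrite ln_gt0 // ltr1n.
rewrite floor_ge_int /log2 ler_pdivlMr // -pmulrn [leLHS]mulr_natl.
rewrite -lnXn ?ltr0n // ler_ln ?posrE ?exprn_gt0 ?ltr0n //.
by apply: lt_le_trans le_pq; rewrite exprn_gt0 ?ltr0n.
Qed.

Lemma vmin_entry (n : nat) (a : 'cV[nat]_n.+1) : exists m, a m ord0 = vmin a.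
Proof.
apply: (big_ind (fun v => exists m, a m ord0 = v)).
- by exists ord0.
- by move=> _ _ [i <-] [j <-]; rewrite /minn; case: ifP; [exists i | exists j].
- by move=> i _; exists i.
Qed.

Theorem theorem6 (R : realType) (n : nat) (a : 'cV[nat]_n.+1) (b : nat)
  (a_gt0 : forall i : 'I_n.+1, (0 < a i ord0)%N)
  (feasible : exists x : 'cV[nat]_n.+1, (a^T *m x) ord0 ord0 = b) :
  exists x : 'cV[nat]_n.+1, (a^T *m x) ord0 ord0 = b /\
    (l0norm x)%:Z <= 1 + Num.floor (log2 ((vmin a)%:R / (vgcd a)%:R : R)).
Proof.
have [x0 <-] := feasible; have [m <-] := vmin_entry n a.
have dvd_g i : (vgcd a %| a i ord0)%N by apply: biggcdn_inf (dvdnn _).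
have [x [xsol le_m]] := sparse_solution _ (fun i => a i ord0)
  (fun i => x0 i ord0) m (vgcd a) a_gt0 dvd_g.
have sumE (y : 'cV[nat]_n.+1) :
    (a^T *m y) ord0 ord0 = (\sum_i a i ord0 * y i ord0)%N.
  by rewrite mxE; apply: eq_bigr => i _; rewrite mxE.
exists (\col_i x i); split.
  by rewrite !sumE -xsol; apply: eq_bigr => i _; rewrite mxE.
have g_gt0 : (0 < vgcd a)%N by apply: dvdn_gt0 (dvd_g m).
apply: le_trans (lerD (lexx 1) (le_floor_log2 R _ _ _ g_gt0 le_m)).
have -> : l0norm (\col_i x i) = #|[set i | x i != 0%N]|.
  by apply: eq_card => i; rewrite !inE mxE.
(* The summand 1 of the bound pays for [m], which may lie in the support. *)
by rewrite (cardsD1 m); case: (_ \in _); rewrite -?PoszD //; lia.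
Qed.
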